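(* Consider nonzero ideals $I_n=\langle\operatorname{Sym}(n)(\mathbf{x}^{A_1},\dots,\mathbf{x}^{A_s})\rangle$, where $A_i\in\{0,1\}^{c\times m}$ for $1\le i\le s$ and $n\ge m$. The number of $\operatorname{Sym}(n)$-orbits needed to minimally generate the Alexander dual $I_n^\vee$ is a polynomial in $n$ whose degree is at most $\binom{c}{\lfloor c/2\rfloor}-1$ if $n$ is sufficiently large. Moreover, there is a linear function $d\colon\mathbb{N}\to\mathbb{N}$ such that, for $n\gg 0$, the least degree of a minimal generator of $I_n^\vee$ equals $d(n)$. The number of $\operatorname{Sym}(n)$-orbits needed to produce the minimal generators of $I_n^\vee$ of degree $d(n)$ is given by a polynomial in $n$.
   Context: $\mathbb{N}$ denotes the positive integers, and $c,m,s$ are fixed positive integers. $R_n=\mathbf{k}[x_{i,j}\mid i\in[c],\ j\in[n]]$ over a field $\mathbf{k}$, with $\operatorname{Sym}(n)$ acting by $\sigma\cdot x_{i,j}=x_{i,\sigma(j)}$. For $A=[a_{i,j}]\in\{0,1\}^{c\times m}$ and $n\geq m$, $\mathbf{x}^A=\prod x_{i,j}^{a_{i,j}}\in R_n$ (equivalently, $A$ is padded by $n-m$ zero columns), and $\langle\operatorname{Sym}(n)(\mathbf{x}^{A_1},\dots,\mathbf{x}^{A_s})\rangle\subset R_n$ is the ideal generated by the $\operatorname{Sym}(n)$-orbits of these monomials. The Alexander dual of a squarefree monomial ideal $I$ is $I^\vee=\langle\mathbf{m}\mid P_{\mathbf{m}}\in\operatorname{Ass}(I)\rangle$, where $\operatorname{Ass}(I)$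 is the set of associated primes of $I$ and $P_{\mathbf{m}}$ is the prime ideal generated by the variables dividing the monomial $\mathbf{m}$. Minimal generators of a monomial ideal are the elements of its unique minimal generating set consisting of monomials; $\operatorname{Sym}(n)$ permutes the minimal generators of $I_n^\vee$, and the numbers in the statement are numbers of orbits under this action.
   Formalization: The function d takes positive integer values but equals an+b (a ≥ 1) only for large n, since e.g. c=1, A=[1 1 1] gives n−2, which is negative at n=1; the least-degree claim is made only when I_n is not the whole ring, as otherwise the dual is zero and has no minimal generator. *)

(* Defs.v *)
From HB Require Import structures.
From mathcomp Require Import all_boot all_order all_fingroup all_algebra.
From mathcomp Require Import mpoly.

Set Implicit Arguments.
Unset Strict Implicit.
Unset Printing Implicit Defensive.

Import GRing.Theory.
Local Open Scope ring_scope.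

Section Ideals.
Variable R : comNzRingType.
Implicit Types (I P G : R -> Prop) (f g : R).

(* Ideals are represented as Prop-valued predicates, since membership in a
   generated ideal is not given by a boolean test. *)
Definition is_ideal I : Prop :=
  [/\ I 0, forall f g, I f -> I g -> I (f + g) & forall h f, I f -> I (h * f)].

Definition ideal_gen G : R -> Prop := fun f =>
  exists r : seq (R * R),
    (forall hg, hg \in r -> G hg.2) /\ f = \sum_(hg <- r) hg.1 * hg.2.

Definition is_prime_ideal P : Prop :=
  [/\ is_ideal P, ~ P 1 & forall f g, P (f * g) -> P f \/ P g].

(* P is in Ass(I), i.e. P is a prime ideal of the form (I : f). *)
Definition assoc_prime I P : Prop :=
  is_prime_ideal P /\ exists f, forall g, P g <-> I (g * f).

End Ideals.

Section MonomialIdeals.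
Variables (K : fieldType) (N : nat).
Local Notation R := {mpoly K[N]}.
Implicit Types (I J : R -> Prop) (G : 'X_{1..N} -> Prop) (u : 'X_{1..N}).

Definition monomial_ideal G : R -> Prop :=
  ideal_gen (fun f => exists2 u, G u & f = 'X_[u]).

(* P_u: the ideal generated by the variables dividing the monomial u. *)
Definition var_ideal u : R -> Prop :=
  ideal_gen (fun f => exists2 k : 'I_N, (0 < u k)%N & f = 'X_k).

Definition alexander_dual I : R -> Prop :=
  monomial_ideal (fun u => assoc_prime I (var_ideal u)).

Definition minimal_monomial_gens J G : Prop :=
  (forall f, monomial_ideal G f <-> J f) /\
  (forall G', (forall u, G' u -> G u) ->
     (forall f, monomial_ideal G' f <-> J f) -> forall u, G u -> G' u).

(* u belongs to the minimal monomial generating set of J (which is unique). *)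
Definition min_gen J u : Prop := exists2 G, minimal_monomial_gens J G & G u.

Definition least_degree G (d : nat) : Prop :=
  (exists2 u, G u & mdeg u = d) /\ (forall u, G u -> (d <= mdeg u)%N).

End MonomialIdeals.

Section SymAction.
Variables (K : fieldType) (c n : nat).

(* R_n is {mpoly K[c * n]}; its variables are indexed by pairs (i, j) through
   the bijection mxvec_index : 'I_c -> 'I_n -> 'I_(c * n). *)
Definition xvar (i : 'I_c) (j : 'I_n) : {mpoly K[c * n]} :=
  'X_(mxvec_index i j).

(* The K-algebra endomorphism x_{i,j} |-> x_{i,sigma j}. *)
Definition sym_act (sigma : 'S_n) (f : {mpoly K[c * n]}) : {mpoly K[c * n]} :=
  f \mPo [tuple mxvec (\matrix_(i < c, j < n) xvar i (sigma j)) ord0 k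
         | k < c * n].

Definition same_orbit (u v : 'X_{1..c * n}) : Prop :=
  exists sigma : 'S_n, sym_act sigma 'X_[u] = 'X_[v].

(* G meets exactly N orbits: r is a system of orbit representatives. Meant for
   Sym(n)-stable G. *)
Definition orbit_count (G : 'X_{1..c * n} -> Prop) (N : nat) : Prop :=
  exists r : 'I_N -> 'X_{1..c * n},
    [/\ forall k, G (r k),
        forall k l, same_orbit (r k) (r l) -> k = l
      & forall u, G u -> exists k, same_orbit (r k) u].

End SymAction.

Section SymIdeal.
Variables (K : fieldType) (c m s : nat).

Definition xmon n (le_mn : (m <= n)%N) (A : 'M[bool]_(c, m)) :
    {mpoly K[c * n]} :=
  \prod_(i < c) \prod_(j < m) xvar K i (widen_ord le_mn j) ^+ A i j.

Definition sym_ideal (A : 'I_s -> 'M[bool]_(c, m)) n (le_mn : (m <= n)%N) :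
    {mpoly K[c * n]} -> Prop :=
  ideal_gen (fun f =>
    exists (sigma : 'S_n) (t : 'I_s), f = sym_act sigma (xmon le_mn (A t))).

End SymIdeal.
Arguments sym_ideal K {c m s} A {n} le_mn _.

(* A function from positive integers to positive integers that is given by
   a * n + b for large n. The intercept b may be negative (e.g. d(n) = n - 2),
   so the formula cannot be required for all n >= 1. *)
Definition linear_pos_fun (d : nat -> nat) : Prop :=
  (forall n, (0 < n)%N -> (0 < d n)%N) /\
  exists (a : nat) (b : int) (n0 : nat), (0 < a)%N /\
    forall n, (n0 <= n)%N -> (d n)%:Z = a%:Z * n%:Z + b.

(* Main.v *)
(* The minimal generators of the dual are the minimal vertex covers of the
   hypergraph on [c] x [n] whose edges are the supports of the monomials
   sigma(x^(A_t)). A cover is recorded by its column types, the complements of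
   its columns; up to Sym(n) only the vector v of multiplicities of the types
   X in 2^[c] matters. Whether v comes from a minimal cover depends only on the
   truncations min(v X, m + 1). Fixing the truncations leaves a composition
   count in the types X with v X > m, a binomial coefficient that is polynomial
   in n of degree one less than the number of such types. These types form an
   antichain, so Sperner's theorem bounds the degree. For a fixed truncation the
   least degree of a cover is linear in n, reached by putting all the excess on
   the largest of those types, and finitely many linear functions have an
   eventual minimum. *)
Require Import Defs.
From HB Require Import structures.
From mathcomp Require Import all_boot all_order all_fingroup all_algebra.
From mathcomp Require Import mpoly zify.

Set Implicit Arguments.
Unset Strict Implicit.
Unset Printing Implicit Defensive.

Import GRing.Theory Num.Theory.
Local Open Scope ring_scope.

(** * Monomial ideals and the dual of an edge ideal *)

Section IdealGen.
Variable R : comNzRingType.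
Implicit Types (I P G : R -> Prop) (f g : R).

Lemma ideal_gen_is_ideal G : is_ideal (ideal_gen G).
Proof.
split.
- by exists [::]; rewrite big_nil.
- move=> f g [r [Gr ->]] [r' [Gr' ->]]; exists (r ++ r'); rewrite big_cat.
  by split=> // hg; rewrite mem_cat => /orP [/Gr|/Gr'].
- move=> h f [r [Gr ->]]; exists [seq (h * x.1, x.2) | x <- r].
  split; first by move=> hg /mapP [x /Gr Gx ->].
  by rewrite big_map mulr_sumr; apply: eq_bigr => x _; rewrite mulrA.
Qed.

Lemma ideal_gen_id G f : G f -> ideal_gen G f.
Proof.
by move=> Gf; exists [:: (1, f)]; rewrite big_seq1 mul1r; split=> // hg /[!inE] /eqP->.
Qed.

Lemma ideal_gen_min G I : is_ideal I -> (forall f, G f -> I f) ->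
  forall f, ideal_gen G f -> I f.
Proof.
move=> [I0 ID IM] GI f [r [Gr ->]]; rewrite big_seq.
by apply: big_ind => // hg hgr; apply/IM/GI/Gr.
Qed.

End IdealGen.

Section MonomialIdealTheory.
Variables (K : fieldType) (N : nat).
Local Notation R := {mpoly K[N]}.
Implicit Types (I J : R -> Prop) (G : 'X_{1..N} -> Prop) (u v w : 'X_{1..N}).
Implicit Types (f g : R) (U E : {set 'I_N}).

(** The polynomials whose support monomials are all divisible by generators form an ideal containing
    the generators; conversely each term of such an [f] is a multiple of a generator, and [f] is the
    sum of its terms. *)
Lemma monomial_idealP G f :
  monomial_ideal G f <->
  forall w, w \in msupp f -> exists2 u, G u & (u <= w)%MM.
Proof.
split.
  apply: (ideal_gen_min (I := fun f => forall w, w \in msupp f ->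
    exists2 u, G u & (u <= w)%MM)) => [|{}f [u Gu ->] w]; last first.
    by rewrite msuppX inE => /eqP->; exists u => //; apply: lepm_refl.
  split=> [w|{}f g Qf Qg w /msuppD_le|h {}f Qf w /msuppM_le].
  - by rewrite msupp0.
  - by rewrite mem_cat => /orP [/Qf|/Qg].
  - case/allpairsP=> -[v1 v2] /= [_ /Qf [u Gu le_u] ->]; exists u => //.
    by apply: lepm_trans le_u _; rewrite lem_addl.
move=> Qf; have [I0 ID IM] :=
  ideal_gen_is_ideal (fun f : R => exists2 u, G u & f = 'X_[u]).
rewrite [f]mpolyE big_seq; apply: big_ind => // w /Qf [u Gu /submK <-].
rewrite mpolyXD -mul_mpolyC mulrA; apply/IM/ideal_gen_id.
by exists u.
Qed.

Lemma monomial_idealX G w :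
  monomial_ideal G ('X_[w] : R) <-> exists2 u, G u & (u <= w)%MM.
Proof.
rewrite monomial_idealP msuppX; split=> [|Q v /[!inE] /eqP-> //].
by apply; rewrite inE.
Qed.

Lemma monomial_ideal_msupp G f :
  monomial_ideal G f <-> forall w, w \in msupp f -> monomial_ideal G ('X_[w] : R).
Proof.
rewrite monomial_idealP; split=> Q w /Q; first by rewrite monomial_idealX.
by rewrite monomial_idealX.
Qed.

Definition mset E : 'X_{1..N} := [multinom (i \in E : nat) | i < N].
Definition msup u : {set 'I_N} := [set k | (0 < u k)%N].

Lemma msetE E k : mset E k = (k \in E).
Proof. by rewrite mnmE. Qed.

Lemma msup_mset E : msup (mset E) = E.
Proof. by apply/setP=> k; rewrite inE msetE; case: (k \in E). Qed.

Lemma lem_mset E w : (mset E <= w)%MM = (E \subset msup w).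
Proof.
apply/mnm_lepP/subsetP => [le_Ew k kE|sEw k].
  by rewrite inE; have:= le_Ew k; rewrite msetE kE.
by rewrite msetE; case: (boolP (k \in E)) => // /sEw; rewrite inE.
Qed.

Lemma mpolyX_mset E : 'X_[mset E] = \prod_(k in E) 'X_k :> R.
Proof.
rewrite mpolyXE_id [RHS]big_mkcond; apply: eq_bigr => k _.
by rewrite msetE; case: (k \in E).
Qed.

Lemma msupD u v : msup (u + v)%MM = msup u :|: msup v.
Proof. by apply/setP=> k; rewrite !inE mnmDE addn_gt0. Qed.

Lemma msup1 k : msup U_(k)%MM = [set k].
Proof.
by apply/setP=> l; rewrite !inE mnm1E eq_sym; case: (l == k).
Qed.

Lemma mdeg_mset E : mdeg (mset E) = #|E|.
Proof.
rewrite mdegE -sum1_card [RHS]big_mkcond; apply: eq_bigr => k _.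
by rewrite msetE; case: (k \in E).
Qed.

Lemma var_idealP u f :
  var_ideal u f <-> forall w, w \in msupp f -> msup u :&: msup w != set0.
Proof.
have -> : var_ideal u f <->
    monomial_ideal (fun v => exists2 k, k \in msup u & v = U_(k)%MM) f.
  split; apply: (ideal_gen_min (ideal_gen_is_ideal _)) => g.
    by case=> k uk ->; apply: ideal_gen_id; exists U_(k)%MM => //; exists k; rewrite ?inE.
  by case=> v [k /[!inE] uk ->] ->; apply: ideal_gen_id; exists k.
rewrite monomial_idealP; split=> Q w /Q.
  case=> v [k uk ->] /mnm_lepP/(_ k); rewrite mnm1E eqxx => wk.
  by apply/set0Pn; exists k; rewrite in_setI uk inE.
case/set0Pn=> k /setIP [uk /[!inE] wk]; exists U_(k)%MM; first by exists k.
apply/mnm_lepP=> l; rewrite mnm1E; case: eqP => // <-; exact: wk.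
Qed.

(* The variable ideal is the kernel of the substitution that kills the
   variables dividing u, a morphism to a domain. *)
Lemma var_ideal_prime u : is_prime_ideal (@var_ideal K N u).
Proof.
split; first exact: ideal_gen_is_ideal.
  rewrite var_idealP => /(_ 0%MM); rewrite msupp1 inE eqxx => /(_ isT).
  case/set0Pn=> k; rewrite !inE mnm0E ltnn andbF //.
pose lq : N.-tuple R := [tuple (if k \in msup u then 0 else 'X_k) | k < N].
have kill w : ('X_[w] : R) \mPo lq =
    if msup u :&: msup w == set0 then 'X_[w] else 0.
  rewrite comp_mpolyX; case: ifPn => [/eqP dis|/set0Pn [k /setIP [uk wk]]].
    rewrite mpolyXE_id; apply: eq_bigr => k _; rewrite tnth_mktuple.
    case: ifP => // uk; have : k \notin msup w.
      by apply: contra_eqN dis => wk; apply/set0Pn; exists k; rewrite inE uk.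
    by rewrite inE -eqn0Ngt => /eqP->.
  rewrite (bigD1 k) //= tnth_mktuple uk expr0n.
  by move: wk; rewrite inE lt0n => /negPf->; rewrite mul0r.
have ker f : var_ideal u f <-> f \mPo lq = 0.
  rewrite var_idealP comp_mpolyEX; split=> [Q|f0 w wf].
    by rewrite big_seq big1 // => w /Q /negPf uw; rewrite kill uw scaler0.
  (* The substitution fixes monomials prime to [u] and kills the others, so the coefficient of such
     a [w] in the image is its coefficient in [f]. *)
  apply: contraTneq wf => dis; rewrite mcoeff_msupp negbK; apply/eqP.
  have [wf|/memN_msupp_eq0 //] := boolP (w \in msupp f).
  rewrite -[RHS](mcoeff0 _ w) -f0 raddf_sum /=.
  rewrite (bigD1_seq w) ?msupp_uniq //= kill dis eqxx linearZ /= mcoeffX eqxx mulr1.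
  rewrite big1 ?addr0 // => v vw; rewrite kill.
  case: ifP => _; last by rewrite scaler0 mcoeff0.
  by rewrite linearZ /= mcoeffX (negPf vw) mulr0.
move=> f g; rewrite !ker rmorphM /= => /eqP; rewrite mulf_eq0.
by case/orP=> /eqP; [left|right].
Qed.

(** * Edge ideals: associated primes and minimal covers *)

Variable H : {set {set 'I_N}}.

Definition edge_ideal : R -> Prop :=
  monomial_ideal (fun u => exists2 E, E \in H & u = mset E).

(* Minimality is stated locally: every vertex of U is the only vertex of U on
   some edge. *)
Definition min_cover U : bool :=
  [forall E in H, E :&: U != set0] &&
  [forall k in U, [exists E in H, E :&: U == [set k]]].

Lemma min_coverP U :
  reflect ((forall E, E \in H -> E :&: U != set0) /\
           (forall k, k \in U -> exists2 E, E \in H & E :&: U = [set k]))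
          (min_cover U).
Proof.
apply: (iffP andP) => -[cov mini]; split.
- by move=> E HE; apply: (forall_inP cov).
- by move=> k /(forall_inP mini) /exists_inP [E HE /eqP]; exists E.
- exact/forall_inP.
- by apply/forall_inP=> k /mini [E HE /eqP EU]; apply/exists_inP; exists E.
Qed.

(** A private edge of [k] in [V] must be met by [U], and inside [V] it can only be met in [k]. *)
Lemma min_cover_antichain U V :
  min_cover U -> min_cover V -> U \subset V -> U = V.
Proof.
move=> /min_coverP [covU _] /min_coverP [_ minV] sUV.
apply/eqP; rewrite eqEsubset sUV /=.
apply/subsetP=> k /minV [E HE EV]; have /set0Pn [l /setIP [lE lU]] := covU E HE.
have : l \in E :&: V by rewrite inE lE (subsetP sUV).
by rewrite EV inE => /eqP <-.
Qed.

Lemma edge_idealX w :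
  edge_ideal 'X_[w] <-> [exists E in H, E \subset msup w].
Proof.
rewrite /edge_ideal monomial_idealX; split=> [[u [E HE ->]]|/exists_inP [E HE sEw]].
  by rewrite lem_mset => sEw; apply/exists_inP; exists E.
by exists (mset E); [exists E | rewrite lem_mset].
Qed.

Variable I : R -> Prop.
Hypothesis IE : forall f, I f <-> edge_ideal f.

Lemma edge_idealMX f v :
  I (f * 'X_[v]) <->
  forall w, w \in msupp f -> [exists E in H, E \subset msup (w + v)%MM].
Proof.
rewrite IE /edge_ideal monomial_ideal_msupp; split=> Q w wf.
  by apply/edge_idealX/Q; rewrite (perm_mem (msuppMX _ _)) addmC; apply: map_f.
move: wf; rewrite (perm_mem (msuppMX _ _)) => /mapP [v' v'f ->].
by apply/edge_idealX; rewrite addmC; apply: Q.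
Qed.

(** For a minimal cover [U], the product of the variables outside [U] is a witness. Conversely an
    arbitrary witness [f] can be replaced by one of its terms: a term outside [I] already forces a
    private edge for each variable dividing [u]. *)
Lemma assoc_prime_edge u : assoc_prime I (var_ideal u) <-> min_cover (msup u).
Proof.
set U := msup u; split=> [[[_ n1P _] [f fP]]|/min_coverP [cov mini]]; last first.
  split; first exact: var_ideal_prime.
  exists 'X_[mset (~: U)] => g; rewrite edge_idealMX var_idealP.
  split=> Q w /Q; rewrite msupD msup_mset -/U.
    case/set0Pn=> k /setIP [kU kw]; have [E HE EU] := mini k kU.
    apply/exists_inP; exists E => //; apply/subsetP=> l lE; rewrite in_setU in_setC.
    case: (boolP (l \in U)) => [lU|]; last by rewrite orbT.
    have : l \in E :&: U by rewrite inE lE.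
    by rewrite EU inE => /eqP->; rewrite kw.
  case/exists_inP=> E /cov /set0Pn [k /setIP [kE kU]] /subsetP/(_ k kE).
  rewrite in_setU in_setC kU orbF => kw.
  by apply/set0Pn; exists k; rewrite inE kU.
(* The prime does not contain 1, so [f] is not in [I] and some term [w] of [f] contains no edge. *)
have: ~~ all (fun w => [exists E in H, E \subset msup w]) (msupp f).
  apply: contra_notN n1P => /allP Q; apply/fP; rewrite mul1r IE.
  by apply/monomial_ideal_msupp=> w /Q /edge_idealX.
case/allPn=> w wf nHw.
have HX v : var_ideal u ('X_[v] : R) -> [exists E in H, E \subset msup (w + v)%MM].
  by move/fP; rewrite mulrC edge_idealMX; apply.
have minU k : k \in U -> exists2 E, E \in H & k \in E /\ E \subset k |: msup w.
  move=> kU; have /HX : var_ideal u ('X_k : R).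
    by apply/var_idealP=> v; rewrite msuppX inE => /eqP->; apply/set0Pn; exists k;
       rewrite msup1 in_setI kU inE eqxx.
  case/exists_inP=> E HE; rewrite msupD msup1 setUC => sE; exists E => //; split=> //.
  apply: contraNT nHw => kE; apply/exists_inP; exists E => //.
  apply/subsetP=> l lE; have := subsetP sE l lE; rewrite in_setU1.
  by case/orP=> // /eqP lk; rewrite -lk lE in kE.
(* Otherwise the edge inside [k |: msup w] would lie in [msup w]. Hence that edge meets [U] in [k]
   alone. *)
have Uw k : k \in U -> k \notin msup w.
  move=> /minU [E HE [_ sE]]; apply: contra nHw => kw.
  apply/exists_inP; exists E => //; apply: subset_trans sE _.
  by rewrite subUset sub1set kw /=.
apply/min_coverP; split=> [E HE|k kU].
  have : I ('X_[mset E] * f).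
    by rewrite mulrC edge_idealMX => v _; apply/exists_inP; exists E;
       rewrite // msupD msup_mset subsetUr.
  by move/fP/var_idealP=> /(_ (mset E)); rewrite msuppX inE msup_mset setIC; apply.
have [E HE [kE sE]] := minU k kU; exists E => //.
apply/setP=> l; rewrite in_setI in_set1; apply/andP/eqP => [[lE lU]|->//].
by have:= subsetP sE l lE; rewrite in_setU1 (negPf (Uw _ lU)) orbF => /eqP.
Qed.

Lemma alexander_dualX w :
  alexander_dual I ('X_[w] : R) <-> exists2 U, min_cover U & U \subset msup w.
Proof.
rewrite /alexander_dual monomial_idealX.
split=> [[u /assoc_prime_edge mU /mnm_lepP le_uw]|[U mU sU]].
  exists (msup u) => //; apply/subsetP=> k; rewrite !inE => uk.
  exact: leq_trans uk (le_uw k).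
by exists (mset U); [apply/assoc_prime_edge; rewrite msup_mset | rewrite lem_mset].
Qed.

(** The generators defining the dual need not be squarefree, but their squarefree parts [G0]
    suffice. Any generating set contains [G0]: a generator [w] dividing [v] in [G0] lies above a
    minimal cover, which equals [msup v] by the antichain property, so [w = v]. *)
Lemma min_gen_dual u :
  min_gen (alexander_dual I) u <-> min_cover (msup u) /\ u = mset (msup u).
Proof.
pose G0 v := min_cover (msup v) /\ v = mset (msup v).
have G0J f : monomial_ideal G0 f <-> alexander_dual I f.
  rewrite /alexander_dual !monomial_idealP; split=> Q w /Q [v].
    by case=> mv vE le_vw; exists v => //; apply/assoc_prime_edge.
  move=> /assoc_prime_edge mv /mnm_lepP le_vw; exists (mset (msup v)).
    by rewrite /G0 msup_mset.
  rewrite lem_mset; apply/subsetP=> k; rewrite !inE => vk.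
  exact: leq_trans vk (le_vw k).
have sub G : (forall f, monomial_ideal G f <-> alexander_dual I f) ->
    forall v, G0 v -> G v.
  move=> GJ v [mv vE]; have : alexander_dual I ('X_[v] : R).
    by apply/alexander_dualX; exists (msup v).
  move/GJ/monomial_idealX => [w Gw le_wv].
  have : alexander_dual I ('X_[w] : R).
    by apply/GJ/monomial_idealX; exists w => //; apply: lepm_refl.
  move/alexander_dualX => [U mU sUw].
  have sU : mset U == v.
    rewrite vE; apply/eqP; congr mset; apply: min_cover_antichain => //.
    apply: subset_trans sUw _; apply/subsetP=> k; rewrite !inE => wk.
    exact: leq_trans wk (mnm_lepP le_wv k).
  suff -> : v = w by [].
  apply/mnmP=> k; apply/eqP; rewrite eqn_leq (mnm_lepP le_wv) andbT.
  by apply: mnm_lepP k; rewrite -(eqP sU) lem_mset.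
split=> [[G [GJ minG] Gu]|G0u].
  exact: minG (sub G GJ) G0J u Gu.
exists G0 => //; split=> // G' _ G'J v; exact: sub.
Qed.

End MonomialIdealTheory.
(** * Column types of covers *)

Section ColumnTypes.
Variables (c m s : nat) (A : 'I_s -> 'M[bool]_(c, m)).
Implicit Types (v w : {set 'I_c} -> nat) (X Y Z : {set 'I_c}).

Definition column t j : {set 'I_c} := [set i | A t i j].

Definition profile n (S : 'I_n -> {set 'I_c}) X : nat := #|[set j | S j == X]|.

(* Some x^(A_t) divides a monomial with v X columns of support X. *)
Definition dependent v : bool :=
  [exists t, [exists T : {ffun 'I_m -> {set 'I_c}},
    [forall j, column t j \subset T j] && [forall X, profile T X <= v X]%N]].

Definition move v X Y : {set 'I_c} -> nat :=
  fun Z => (v Z - (Z == X) + (Z == Y))%N.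

(** Types are complements of the columns of a cover, so enlarging a type by [i] removes one vertex
    from the cover. The guard [0 < v X] makes the truncated subtraction in [move] exact. *)
Definition maximal_independent v : bool :=
  ~~ dependent v &&
  [forall X, forall i, (0 < v X)%N && (i \notin X) ==> dependent (move v X (i |: X))].

Lemma profile_le n (S : 'I_n -> {set 'I_c}) X : (profile S X <= n)%N.
Proof. by rewrite -[leqRHS](card_ord n) max_card. Qed.

Lemma count_profile n (S : 'I_n -> {set 'I_c}) X :
  count_mem X [seq S j | j <- enum 'I_n] = profile S X.
Proof. by rewrite count_map -sum1_count big_enum_cond sum1dep_card. Qed.

Lemma sum_profile n (S : 'I_n -> {set 'I_c}) (F : {set 'I_c} -> nat) :
  (\sum_X profile S X * F X = \sum_j F (S j))%N.
Proof.
rewrite [RHS](partition_big S xpredT) //=; apply: eq_bigr => X _.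
rewrite (eq_bigr (fun=> F X)) => [|j /eqP-> //].
by rewrite sum_nat_const /profile cardsE.
Qed.

Lemma eq_profile n (S S' : 'I_n -> {set 'I_c}) :
  profile S =1 profile S' <-> exists sigma : 'S_n, forall j, S' (sigma j) = S j.
Proof.
split=> [eqS|[sigma Es] X]; last first.
  rewrite /profile -(card_imset _ (@perm_inj _ sigma)); apply: eq_card => j.
  rewrite inE; apply/imsetP/eqP=> [[k /[!inE] /eqP <- ->] //|<-].
  by exists (sigma^-1 j)%g; rewrite ?inE ?permKV // -Es permKV.
have /tuple_permP [sigma Es] :
    perm_eq [seq S j | j <- enum 'I_n] [tuple S' j | j < n].
  by apply/allP=> X _ /=; rewrite !count_profile eqS.
exists sigma => j; have := congr1 (fun r => nth set0 r j) Es.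
rewrite (nth_map j) ?size_enum_ord // nth_ord_enum.
by rewrite -tnth_nth tnth_mktuple tnth_mktuple.
Qed.

(** A witness [T] has only [m] columns, so it uses each type at most [m] times. *)
Lemma dependent_le v w :
  (forall X, minn (v X) m <= w X)%N -> dependent v -> dependent w.
Proof.
move=> le_vw /existsP [t /existsP [T /andP [AT /forallP Tv]]].
apply/existsP; exists t; apply/existsP; exists T; rewrite AT /=.
by apply/forallP=> X; apply: leq_trans (le_vw X); rewrite leq_min Tv profile_le.
Qed.

Lemma eq_dependent v w :
  (forall X, minn (v X) m = minn (w X) m) -> dependent v = dependent w.
Proof.
move=> eq_vw; apply/idP/idP; apply: dependent_le => X.
  by rewrite eq_vw geq_minl.
by rewrite -eq_vw geq_minl.
Qed.

(** The bound is [m.+1] rather than [m] because a move first takes away one column of type [X], and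
    what is left must still be known up to [m]. *)
Lemma eq_maximal_independent v w :
  (forall X, minn (v X) m.+1 = minn (w X) m.+1) ->
  maximal_independent v = maximal_independent w.
Proof.
move=> eq_vw; rewrite /maximal_independent (eq_dependent (w := w)); last first.
  by move=> X; have := eq_vw X; lia.
congr andb; apply: eq_forallb => X; apply: eq_forallb => i.
have -> : (0 < v X)%N = (0 < w X)%N by have := eq_vw X; lia.
case: (ltnP 0 (w X)) => //= w0; congr implb; apply: eq_dependent => Z.
rewrite /move; have := eq_vw Z; case: eqP => [->|_]; last by lia.
by have := eq_vw X; lia.
Qed.

Lemma dependentP n (le_mn : (m <= n)%N) (S : 'I_n -> {set 'I_c}) :
  reflect (exists t (sigma : 'S_n),
             forall j, column t j \subset S (sigma (widen_ord le_mn j)))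
          (dependent (profile S)).
Proof.
apply: (iffP existsP) => [[t /existsP [T /andP [/forallP AT /forallP TS]]]|].
  have /count_subseqP [r subr permr] : forall X,
      (count_mem X [seq T j | j <- enum 'I_m] <=
       count_mem X [seq S j | j <- enum 'I_n])%N.
    by move=> X; rewrite !count_profile.
  have [r' permr'] := perm_to_subseq subr.
  have : perm_eq ([seq T j | j <- enum 'I_m] ++ r') [tuple S j | j < n].
    by rewrite perm_sym (perm_trans permr') // perm_cat2r perm_sym.
  case/tuple_permP=> sigma Es; exists t, sigma => j.
  have := congr1 (fun q => nth set0 q j) Es.
  rewrite nth_cat size_map size_enum_ord ltn_ord (nth_map j) ?size_enum_ord //.
  rewrite nth_ord_enum -[X in nth _ _ X]/(val (widen_ord le_mn j)).
  by rewrite -tnth_nth tnth_mktuple tnth_mktuple => <-.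
case=> t [sigma AS]; exists t; apply/existsP.
exists [ffun j => S (sigma (widen_ord le_mn j))].
apply/andP; split; first by apply/forallP=> j; rewrite ffunE.
apply/forallP=> X; rewrite /profile.
have inj : injective (fun j => sigma (widen_ord le_mn j)).
  by move=> j k /perm_inj /(congr1 val) /= /val_inj.
rewrite -(card_imset _ inj); apply: subset_leq_card.
by apply/subsetP=> _ /imsetP [j /[!(inE, ffunE)] Sj ->].
Qed.

Definition recolumn n (S : 'I_n -> {set 'I_c}) j X : 'I_n -> {set 'I_c} :=
  fun k => if k == j then X else S k.

Lemma profile_recolumn n (S : 'I_n -> {set 'I_c}) j Y :
  profile (recolumn S j Y) =1 move (profile S) (S j) Y.
Proof.
move=> X; rewrite /profile /move (cardsD1 j) [in RHS](cardsD1 j) !inE.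
rewrite /recolumn eqxx [X == S j]eq_sym addKn addnC.
rewrite [Y == X]eq_sym; congr addn; apply: eq_card => k; rewrite !inE.
by case: eqP.
Qed.

Lemma maximal_independentP n (S : 'I_n -> {set 'I_c}) :
  reflect (~~ dependent (profile S) /\
           forall i j, i \notin S j -> dependent (profile (recolumn S j (i |: S j))))
          (maximal_independent (profile S)).
Proof.
apply: (iffP andP) => -[nd mx]; split=> //.
  move=> i j Sij; rewrite (eq_dependent (w := move (profile S) (S j) (i |: S j))).
    move/forallP/(_ (S j))/forallP/(_ i)/implyP: mx; apply; rewrite Sij andbT.
    by apply/card_gt0P; exists j; rewrite inE.
  by move=> X; rewrite profile_recolumn.
apply/forallP=> X; apply/forallP=> i; apply/implyP=> /andP [/card_gt0P [j]].
rewrite inE => /eqP <- /mx.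
rewrite (@eq_dependent _ (move (profile S) (S j) (i |: S j))) //.
by move=> Z; rewrite profile_recolumn.
Qed.

End ColumnTypes.

(** * The symmetric group action and the hypergraph of the symmetric ideal *)

Section SymmetricEdges.
Variables (K : fieldType) (c n : nat).
Implicit Types (u : 'X_{1..c * n}) (U : {set 'I_(c * n)}) (sigma : 'S_n).
Local Notation R := {mpoly K[c * n]}.

Definition cell (p : 'I_c * 'I_n) : 'I_(c * n) := mxvec_index p.1 p.2.

Lemma cell_bij : bijective cell.
Proof.
have [g gK Kg] := curry_mxvec_bij c n; exists g => [[i j]|k].
  exact: gK (i, j) isT.
have := Kg k isT; rewrite /cell; by case: (g k).
Qed.

Lemma mnm_cellP u v : u = v <-> forall i j, u (mxvec_index i j) = v (mxvec_index i j).
Proof. by split=> [->//|E]; apply/mnmP=> k; case/mxvec_indexP: k. Qed.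

Lemma sym_act_var sigma (i : 'I_c) j :
  sym_act sigma (xvar K i j) = xvar K i (sigma j).
Proof. by rewrite /sym_act /xvar comp_mpolyXU -tnth_nth tnth_mktuple mxvecE mxE. Qed.

(** The image of a monomial is the monomial with exponents moved by the inverse of [sigma], and a
    monomial is determined by its support. *)
Lemma sym_actX sigma u u' :
  sym_act sigma 'X_[u] = 'X_[u'] :> R <->
  forall i j, u' (mxvec_index i (sigma j)) = u (mxvec_index i j).
Proof.
pose act : 'X_{1..c * n} :=
  [multinom mxvec (\matrix_(i < c, j < n) u (mxvec_index i ((sigma^-1)%g j))) ord0 k
  | k < c * n].
have actE i j : act (mxvec_index i j) = u (mxvec_index i ((sigma^-1)%g j)).
  by rewrite mnmE mxvecE mxE.
have -> : sym_act sigma 'X_[u] = 'X_[act] :> R.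
  rewrite [RHS]mpolyXE_id /sym_act comp_mpolyX.
  rewrite (reindex cell) ?[RHS](reindex cell); try exact: onW_bij cell_bij.
  rewrite [RHS](reindex (fun p => (p.1, sigma p.2))) /=; last first.
    by exists (fun p => (p.1, (sigma^-1)%g p.2)) => -[i j] _ /=; rewrite ?permK ?permKV.
  apply: eq_bigr => -[i j] _; rewrite /cell /= tnth_mktuple mxvecE mxE.
  by rewrite actE permK.
split=> [/(congr1 (fun f : R => msupp f : seq _))|E].
  by rewrite !msuppX => -[<-] i j; rewrite actE permK.
by congr ('X_[_]); apply/mnm_cellP=> i j; rewrite actE -E permKV.
Qed.

Definition coltype U (j : 'I_n) : {set 'I_c} := [set i | mxvec_index i j \notin U].

Lemma coltype_surj (S : 'I_n -> {set 'I_c}) : exists U, coltype U =1 S.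
Proof.
exists [set cell p | p : 'I_c * 'I_n & p.1 \notin S p.2] => j.
apply/setP=> i; rewrite inE -[mxvec_index i j]/(cell (i, j)).
by rewrite mem_imset ?inE ?negbK //; apply: bij_inj cell_bij.
Qed.

Lemma same_orbit_mset U U' :
  same_orbit K (mset U) (mset U') <-> profile (coltype U) =1 profile (coltype U').
Proof.
rewrite eq_profile; split=> -[sigma E]; exists sigma.
  move/sym_actX: E => E j; apply/setP=> i; rewrite !inE.
  by have := E i j; rewrite !msetE; do 2!case: (_ \in _).
apply/sym_actX=> i j; move/setP/(_ i): (E j); rewrite !inE !msetE.
by move/negb_inj->.
Qed.

(** A column of type [X] contains [c - #|X|] vertices of [U]. *)
Lemma mdeg_coltype U :
  mdeg (mset U) = (\sum_X profile (coltype U) X * (c - #|X|))%N.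
Proof.
rewrite sum_profile mdeg_mset -sum1_card (reindex cell) /=; last exact: onW_bij cell_bij.
rewrite (eq_bigl (fun p => (true && (p.1 \notin coltype U p.2)))); last first.
  by case=> i j; rewrite inE negbK.
rewrite -(pair_big_dep xpredT (fun i j => i \notin coltype U j) (fun _ _ => 1%N)) /=.
rewrite (exchange_big_dep xpredT) //=; apply: eq_bigr => j _.
rewrite sum1dep_card (_ : [set x | _] = ~: coltype U j); last first.
  by apply/setP=> i; rewrite !inE.
by rewrite cardsCs setCK card_ord.
Qed.

Variables (m s : nat) (A : 'I_s -> 'M[bool]_(c, m)) (le_mn : (m <= n)%N).

Definition edge (q : 'I_s * 'S_n) : {set 'I_(c * n)} :=
  [set cell (p.1, q.2 (widen_ord le_mn p.2)) | p : 'I_c * 'I_m & A q.1 p.1 p.2].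

Definition edges : {set {set 'I_(c * n)}} := [set edge q | q : 'I_s * 'S_n].

Lemma edge_inj sigma :
  injective (fun p : 'I_c * 'I_m => cell (p.1, sigma (widen_ord le_mn p.2))).
Proof.
move=> [i j] [i' j'] /(bij_inj cell_bij) [-> /perm_inj /(congr1 val) /= /val_inj ->].
by [].
Qed.

Lemma mem_edge t sigma i j :
  (mxvec_index i (sigma (widen_ord le_mn j)) \in edge (t, sigma)) = A t i j.
Proof.
rewrite -[mxvec_index _ _]/((fun p => cell (p.1, sigma (widen_ord le_mn p.2))) (i, j)).
by rewrite mem_imset ?inE //; apply: edge_inj.
Qed.

Lemma sym_act_xmon t sigma :
  sym_act sigma (xmon K le_mn (A t)) = 'X_[mset (edge (t, sigma))].
Proof.
rewrite mpolyX_mset big_imset /=; last by move=> p p' _ _ /edge_inj.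
rewrite /xmon /sym_act rmorph_prod /=.
under eq_bigr => i _.
  rewrite rmorph_prod /=.
  under eq_bigr => j _ do rewrite rmorphXn /= -/(sym_act _ _) sym_act_var.
  over.
rewrite pair_bigA /= [RHS]big_mkcond; apply: eq_bigr => -[i j] _.
by rewrite inE /=; case: (A t i j).
Qed.

Lemma sym_ideal_edges f : sym_ideal K A le_mn f <-> edge_ideal edges f.
Proof.
split; apply: (ideal_gen_min (ideal_gen_is_ideal _)) => g.
  case=> sigma [t ->]; rewrite sym_act_xmon; apply: ideal_gen_id.
  exists (mset (edge (t, sigma))) => //; exists (edge (t, sigma)) => //.
  exact: imset_f.
case=> u [_ /imsetP [[t sigma] _ ->] ->] ->; apply: ideal_gen_id.
by exists sigma, t; rewrite sym_act_xmon.
Qed.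

Lemma edge_disjoint t sigma U :
  (edge (t, sigma) :&: U == set0) =
  [forall j, column A t j \subset coltype U (sigma (widen_ord le_mn j))].
Proof.
apply/eqP/forallP=> [dis j|sub].
  apply/subsetP=> i; rewrite !inE -(mem_edge t sigma) => iE.
  apply: contra_eqN dis => iU; apply/set0Pn.
  by exists (mxvec_index i (sigma (widen_ord le_mn j))); rewrite inE iE.
apply/setP=> k; rewrite !inE; apply/negP=> /andP [/imsetP [[i j]]].
rewrite inE /= => Aij ->; apply/negP.
by have := subsetP (sub j) i; rewrite !inE; apply.
Qed.

Lemma no_edge_independent U :
  [exists E in edges, E :&: U == set0] = dependent A (profile (coltype U)).
Proof.
apply/exists_inP/(dependentP _ le_mn) => [[_ /imsetP [[t sigma] _ ->]]|].
  by rewrite edge_disjoint => /forallP sub; exists t, sigma.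
case=> t [sigma /forallP sub]; exists (edge (t, sigma)); first exact: imset_f.
by rewrite edge_disjoint.
Qed.

Lemma coltypeD1 U i j :
  coltype (U :\ mxvec_index i j) =1 recolumn (coltype U) j (i |: coltype U j).
Proof.
have inj i' j' : (mxvec_index i' j' == mxvec_index i j) = ((i', j') == (i, j)).
  rewrite -[mxvec_index i' j']/(cell (i', j')) -[mxvec_index i j]/(cell (i, j)).
  exact/inj_eq/bij_inj/cell_bij.
move=> k; apply/setP=> l; rewrite /recolumn !inE inj xpair_eqE.
by case: (altP (k =P j)) => [->|_]; rewrite !inE ?andbT ?andbF //= negb_and negbK.
Qed.

(** A vertex of a cover has a private edge exactly when removing it leaves some edge uncovered, and
    this removal enlarges one column type. *)
Lemma min_cover_edges U :
  min_cover edges U = maximal_independent A (profile (coltype U)).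
Proof.
have depU V : [exists E in edges, E :&: V == set0] = dependent A (profile (coltype V)).
  exact: no_edge_independent.
apply/min_coverP/maximal_independentP=> -[cov mini]; split.
- rewrite -depU; apply/exists_inPn=> E; exact: cov.
- move=> i j; rewrite inE negbK => /mini [E HE EU].
  rewrite (@eq_dependent _ _ _ A _ (profile (coltype (U :\ mxvec_index i j)))) => [|X].
    rewrite -depU; apply/exists_inP; exists E => //.
    by rewrite setIDA EU setDv.
  by congr minn; apply: eq_card => k; rewrite !inE coltypeD1.
- by move=> E HE; move: cov; rewrite -depU => /exists_inPn/(_ E HE).
- move=> k; case/mxvec_indexP: k => i j kU; have := mini i j.
  rewrite inE negbK => /(_ kU).
  rewrite (@eq_dependent _ _ _ A _ (profile (coltype (U :\ mxvec_index i j)))) => [|X]; last first.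
    by congr minn; apply: eq_card => k; rewrite !inE coltypeD1.
  rewrite -depU => /exists_inP [E HE]; rewrite setIDA setD_eq0 => sEU; exists E => //.
  move: cov; rewrite -depU => /exists_inPn/(_ E HE).
  by move: sEU; rewrite subset1 => /orP [/eqP->|->].
Qed.

Lemma min_gen_sym_ideal u :
  min_gen (alexander_dual (sym_ideal K A le_mn)) u <->
  exists2 U, maximal_independent A (profile (coltype U)) & u = mset U.
Proof.
rewrite (min_gen_dual sym_ideal_edges) min_cover_edges.
split=> [[mU uE]|[U mU ->]]; first by exists (msup u).
by rewrite msup_mset.
Qed.

End SymmetricEdges.
(** * Sperner's theorem *)

Section Sperner.
Variable T : finType.
Implicit Types (U X Y : {set T}) (F : {set {set T}}).

(* The LYM inequality with denominators cleared; the induction deletes one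
   element of U, over which the inequalities are summed. *)
Lemma lym_inequality U F :
  (forall X, X \in F -> X \subset U) ->
  {in F &, forall X Y, X \subset Y -> X = Y} ->
  (\sum_(X in F) #|X|`! * (#|U| - #|X|)`! <= #|U|`!)%N.
Proof.
move: {2}#|U| (erefl #|U|) => k; elim: k U F => [|k IH] U F cU FU anti.
  have F0 X : X \in F -> X = set0.
    by move=> /FU; rewrite (cards0_eq cU) subset0 => /eqP.
  rewrite cU; apply: (@leq_trans (\sum_(X in [set set0 : {set T}]) 1)%N).
    rewrite big_mkcond [leqRHS]big_mkcond; apply: leq_sum => X _.
    by case: ifP => // /F0->; rewrite inE eqxx cards0.
  by rewrite big_set1.
(* If [U] is a member, the antichain is [U] alone. Otherwise all members are proper subsets, which
   makes the later subtractions exact. *)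
have [UF|UF] := boolP (U \in F).
  rewrite (eq_bigl (pred1 U)) => [|X]; last first.
    by apply/idP/eqP=> [XF|->//]; apply: anti => //; apply: FU.
  by rewrite big_pred1_eq subnn muln1.
have ltX X : X \in F -> (#|X| < k.+1)%N.
  move=> XF; rewrite -cU proper_card // properEneq FU // andbT.
  by apply: contraNneq UF => <-.
have step x : x \in U ->
    (\sum_(X in F | x \notin X) #|X|`! * (k - #|X|)`! <= k`!)%N.
  move=> xU; have cUx : #|U :\ x| = k by move: cU; rewrite (cardsD1 x) xU => -[].
  have := IH (U :\ x) [set X in F | x \notin X] cUx; rewrite cUx.
  rewrite (eq_bigl (fun X => (X \in F) && (x \notin X))) => [|X]; last by rewrite inE.
  apply=> [X|X Y]; rewrite !inE; first by case/andP=> /FU sXU xX; rewrite subsetD1 sXU.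
  by move=> /andP [XF _] /andP [YF _]; apply: anti.
rewrite cU; have <- : (\sum_(x in U) k`! = k.+1`!)%N by rewrite sum_nat_const cU.
apply: leq_trans (leq_sum _ step); rewrite (exchange_big_dep (mem F)) /=; last first.
  by move=> x X _ /andP [].
apply: leq_sum => X XF.
rewrite (eq_bigl (mem (U :\: X))) => [|x]; last by rewrite !inE XF andbC.
(* [X] is counted once for each of its [k.+1 - #|X|] missing elements; this factor turns the
   factorial of [k - #|X|] into that of [k.+1 - #|X|]. *)
rewrite sum_nat_const cardsD (setIidPr (FU _ XF)) cU subSn -1?ltnS ?ltX //.
by rewrite factS mulnCA.
Qed.

(** The ratio of consecutive binomials shows that they increase up to the middle; symmetry covers
    the upper half. *)
Lemma leq_bin_half n k : ('C(n, k) <= 'C(n, n./2))%N.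
Proof.
have up i : (i.*2 < n)%N -> ('C(n, i) <= 'C(n, i.+1))%N.
  move=> lt_in; rewrite -(leq_pmul2l (ltn0Sn i)) mul_bin_left leq_mul2r.
  by apply/orP; right; lia.
have low i : (i <= n./2)%N -> ('C(n, i) <= 'C(n, n./2))%N.
  have: (n./2 <= n./2)%N by [].
  move: {1 3 4}(n./2) => h; elim: h => [|h IH] le_h; first by rewrite leqn0 => /eqP->.
  rewrite leq_eqVlt ltnS => /orP [/eqP-> //|/(IH (ltnW le_h)) le_ih].
  by apply: leq_trans le_ih (up _ _); lia.
case: (leqP k n./2) => [/low //|lt_k]; case: (leqP k n) => [le_kn|/bin_small->//].
by rewrite -bin_sub // low //; lia.
Qed.

(** Each term of the LYM sum times the binomial at [#|X|] is the full factorial, and that binomial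
    is at most the middle one. *)
Lemma sperner F : {in F &, forall X Y, X \subset Y -> X = Y} ->
  (#|F| <= 'C(#|T|, #|T|./2))%N.
Proof.
move=> anti; have := @lym_inequality setT F (fun X _ => subsetT X) anti.
rewrite cardsT => lym; rewrite -(leq_pmul2r (fact_gt0 #|T|)).
apply: leq_trans (leq_mul (leqnn _) lym); rewrite big_distrr /= -sum_nat_const.
apply: leq_sum => X _; rewrite -(bin_fact (max_card (mem X))).
by rewrite leq_mul2r leq_bin_half orbT.
Qed.

End Sperner.

(** * Counting compositions *)

Section Boxes.
Local Open Scope nat_scope.
Variable J : finType.
Implicit Types (L : {set J}) (f : J -> nat).

Definition box n L f : {set {ffun J -> 'I_n.+1}} :=
  [set v : {ffun J -> 'I_n.+1} | (\sum_x v x == n)%N &&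
           [forall x, if x \in L then f x <= v x else v x == f x :> nat]%N].

(** Subtracting [f] leaves the weak compositions of [N] into [#|L|] parts. *)
Lemma card_box n L f : L != set0 -> (\sum_x f x <= n)%N ->
  #|box n L f| = 'C(n - \sum_x f x + #|L|.-1, #|L|.-1).
Proof.
move=> L0 le_fn; set N := (n - \sum_x f x)%N; set k := #|L|.-1.
have cL : size (enum L) = k.+1 by rewrite -cardE prednK // card_gt0.
have [x0 _] := set0Pn _ L0.
rewrite addnC -card_ord_partitions.
(* For [x] outside [L] the index is out of range, so [nth] returns the default [ord0] and the value
   is exactly [f x]. *)
pose g (t : k.+1.-tuple 'I_N.+1) : {ffun J -> 'I_n.+1} :=
  [ffun x => inord (f x + nth ord0 t (index x (enum L)))].
have gE (t : k.+1.-tuple 'I_N.+1) x : \sum_(i <- t) i = N ->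
    g t x = (f x + nth ord0 t (index x (enum L)))%N :> nat.
  move=> st; rewrite ffunE inordK // ltnS.
  have le_f : (f x <= \sum_x f x)%N by rewrite (bigD1 x) //= leq_addr.
  apply: leq_trans (_ : f x + N <= _)%N; last by rewrite /N; lia.
  by rewrite leq_add2l -ltnS ltn_ord.
rewrite -(card_in_imset (f := g)); last first.
  move=> t t' /[!inE] /eqP st /eqP st' gg; apply: eq_from_tnth => i.
  have := congr1 (fun v : {ffun J -> 'I_n.+1} => v (nth x0 (enum L) i) : nat) gg.
  rewrite !gE // index_uniq ?enum_uniq ?cL // => /addnI /val_inj.
  by rewrite -!tnth_nth.
apply: eq_card => v; rewrite inE; apply/andP/imsetP=> [[/eqP sv /forallP fv]|].
  have fvL x : x \in L -> (f x <= v x)%N by move=> xL; have := fv x; rewrite xL.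
  have fvN x : x \notin L -> v x = f x :> nat.
    by move=> xL; have := fv x; rewrite (negPf xL) => /eqP.
  have le_fv x : (f x <= v x)%N by case: (boolP (x \in L)) => [/fvL //|/fvN->].
  have sN : (\sum_x (v x - f x) = N)%N by rewrite sumnB // sv.
  have le_N x : (v x - f x <= N)%N by rewrite -sN (bigD1 x) //= leq_addr.
  pose t := [tuple (inord (v (nth x0 (enum L) i) - f (nth x0 (enum L) i)) : 'I_N.+1)
            | i < k.+1].
  have tE i : (i < k.+1)%N -> nth ord0 t i =
      (v (nth x0 (enum L) i) - f (nth x0 (enum L) i))%N :> nat.
    by move=> lt_i; rewrite -[i]/(val (Ordinal lt_i)) -tnth_nth tnth_mktuple inordK // ltnS.
  have st : \sum_(i <- t) i = N.
    rewrite (big_nth ord0) big_mkord size_tuple; apply: etrans sN.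
    rewrite (bigID (mem L)) /= [X in (_ + X)%N]big1 => [|x /fvN->]; last by rewrite subnn.
    rewrite addn0 -[RHS]big_enum [RHS](big_nth x0) big_mkord cL.
    by apply: eq_bigr => i _; rewrite tE.
  exists t; first by rewrite inE st.
  apply/ffunP=> x; apply: val_inj; rewrite /= gE //.
  have [xL|xL] := boolP (x \in L); last first.
    rewrite nth_default ?addn0 ?fvN // size_tuple -cL memNindex ?mem_enum //.
  have lt_x : (index x (enum L) < k.+1)%N by rewrite -cL index_mem mem_enum.
  by rewrite tE // nth_index ?mem_enum // subnKC // fvL.
case=> t /[!inE] /eqP st ->; split.
  apply/eqP; under eq_bigr => x _ do rewrite gE //.
  rewrite big_split /= [X in _ + X](bigID (mem L)) /= [X in _ + (_ + X)]big1 => [|x xL]; last first.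
    by rewrite nth_default // size_tuple -cL memNindex ?mem_enum.
  rewrite addn0 -[X in _ + X]big_enum [X in _ + X](big_nth x0) big_mkord cL.
  under [X in _ + X] eq_bigr => i _ do rewrite index_uniq ?enum_uniq ?cL //.
  suff -> : (\sum_(i < k.+1) nth ord0 t i = N)%N by rewrite subnKC.
  by rewrite -[RHS]st [RHS](big_nth ord0) big_mkord size_tuple.
apply/forallP=> x; rewrite gE //; case: ifPn => xL; first exact: leq_addr.
by rewrite nth_default ?addn0 // size_tuple -cL memNindex ?mem_enum.
Qed.

Lemma bin_poly k a : exists p : {poly rat}, (size p <= k.+1)%N /\
  forall n, (a <= n)%N -> ('C(n - a + k, k))%:R%R = p.[n%:R]%R.
Proof.
elim: k => [|k [p [szp pE]]].
  by exists 1%R; rewrite size_poly1; split=> // n _; rewrite bin0 hornerE.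
(* Passing from [k] to [k.+1] multiplies the binomial by [(n - a + k.+1) / k.+1]. *)
exists ((k.+1%:R)^-1 *: (p * ('X - (a%:R - k.+1%:R)%:P)))%R; split.
  apply: leq_trans (size_scale_leq _ _) _; apply: leq_trans (size_polyMleq _ _) _.
  by rewrite size_XsubC addn2.
move=> n le_an; rewrite hornerZ hornerM hornerXsubC -pE //.
have k0 : (k.+1%:R != 0 :> rat)%R by rewrite pnatr_eq0.
apply: (mulfI k0); rewrite mulVKf // opprB addrCA -natrB // -natrD -!natrM.
congr (_%:R)%R; rewrite addnS -mul_bin_diag /= mulnC; congr muln; lia.
Qed.

Lemma box_poly L f : L != set0 -> exists p : {poly rat}, (size p <= #|L|)%N /\
  forall n, (\sum_x f x <= n)%N -> #|box n L f|%:R%R = p.[n%:R]%R.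
Proof.
move=> L0; have [p [szp pE]] := bin_poly #|L|.-1 (\sum_x f x)%N.
exists p; split=> [|n le_fn]; first by rewrite prednK ?card_gt0 // in szp.
by rewrite card_box // pE.
Qed.

End Boxes.
(** * Truncations and eventual polynomials *)

Section Counting.
Variables (c m s : nat) (A : 'I_s -> 'M[bool]_(c, m)).
Local Notation J := {set 'I_c}.
Local Open Scope nat_scope.
Implicit Types (X Y Z : J) (t : {ffun J -> 'I_m.+2}).

(* A vector v is classified by the truncation of its entries at m + 1, which
   decides whether v is maximal independent. *)
Definition truncation n (v : {ffun J -> 'I_n.+1}) : {ffun J -> 'I_m.+2} :=
  [ffun X => inord (minn (v X) m.+1)].

Definition saturated t : {set J} := [set X : J | t X == m.+1 :> nat].

Definition truncations : {set {ffun J -> 'I_m.+2}} :=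
  [set t : {ffun J -> 'I_m.+2} |
    maximal_independent A (fun X => t X) && (saturated t != set0)].

Definition max_vectors n : {set {ffun J -> 'I_n.+1}} :=
  [set v : {ffun J -> 'I_n.+1} |
    (\sum_X v X == n) && maximal_independent A (fun X => v X)].

Definition max_size : nat := #|J| * m.+1.

Lemma truncationE n (v : {ffun J -> 'I_n.+1}) X : truncation v X = minn (v X) m.+1 :> nat.
Proof. by rewrite ffunE inordK // ltnS geq_minr. Qed.

Lemma sum_truncation_le t : \sum_X t X <= max_size.
Proof. by rewrite /max_size -sum_nat_const leq_sum // => X _; rewrite -ltnS. Qed.

(** For large [n] the maximal vectors split into disjoint boxes, one per truncation: saturated
    entries are free above [m], all others are fixed. *)
Lemma truncation_box n (v : {ffun J -> 'I_n.+1}) t : max_size < n ->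
  (v \in max_vectors n) && (truncation v == t) =
  (t \in truncations) && (v \in box n (saturated t) (fun X => t X)).
Proof.
move=> lt_n; rewrite !inE.
apply/andP/andP=> [[/andP [/eqP sv mv] /eqP <-]|[/andP [mt t0] /andP [sv /forallP bv]]].
  rewrite sv eqxx; split; last first.
    apply/forallP=> X; rewrite inE truncationE.
    by have [lt|le] := ltnP (v X) m.+1; rewrite ?eqxx ?(ltn_eqF lt) ?eqxx.
  rewrite (@eq_maximal_independent _ _ _ A _ (fun X => v X)) ?mv => [/=|X]; last first.
    by rewrite truncationE -minnA minnn.
  (* With no saturated entry, the sum of [v] would be at most [max_size]. *)
  apply: contraTneq lt_n => t0; rewrite -leqNgt -sv.
  rewrite /max_size -sum_nat_const leq_sum // => X _.
  have : X \notin saturated (truncation v) by rewrite t0 inE.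
  by rewrite inE truncationE; lia.
have vt : truncation v = t.
  apply/ffunP=> X; apply/val_inj; rewrite /= truncationE.
  have := bv X; rewrite inE; have := ltn_ord (t X).
  rewrite ltnS leq_eqVlt; case: eqP => [-> _ /minn_idPr //|_ /= lt_t /eqP->].
  exact/minn_idPl/ltnW.
split; last exact/eqP.
rewrite sv (@eq_maximal_independent _ _ _ A _ (fun X => t X)) // => X.
by rewrite -vt truncationE -minnA minnn.
Qed.

(** The predicate [Q] lets one partition serve both the count of all vectors and the count at a
    given weight. *)
Lemma card_max_vectors n (Q : pred {ffun J -> 'I_n.+1}) : max_size < n ->
  #|[set v in max_vectors n | Q v]| =
  \sum_(t in truncations) #|[set v in box n (saturated t) (fun X => t X) | Q v]|.
Proof.
move=> lt_n; rewrite -sum1dep_card (partition_big (@truncation n) (mem truncations)) /=.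
  apply: eq_bigr => t tP; rewrite -sum1dep_card; apply: eq_bigl => v.
  by rewrite andbAC truncation_box // tP.
move=> v /andP [vM _].
by have := truncation_box v (truncation v) lt_n; rewrite vM eqxx /= => /esym /andP [].
Qed.

(* Columns of type X could be enlarged to Y without creating an edge. *)
Lemma saturated_antichain t : t \in truncations ->
  {in saturated t &, forall X Y, X \subset Y -> X = Y}.
Proof.
rewrite inE => /andP [/andP [nd mx] _] X Y /[!inE] /eqP tX /eqP tY sXY.
apply/eqP; rewrite eqEsubset sXY; apply/subsetP=> i iY; apply/negPn/negP=> iX.
have := forallP (forallP mx X) i; rewrite tX iX /=.
case/existsP=> q /existsP [T /andP [/forallP AT /forallP TP]].
case/negP: nd; apply/existsP; exists q; apply/existsP.
(* The new type [i |: X] lies inside [Y], and [Y] is saturated, so enough columns of type [Y] are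
   available to replace it. *)
exists [ffun j => if T j == i |: X then Y else T j].
apply/andP; split; apply/forallP.
  move=> j; rewrite ffunE; case: eqP (AT j) => // -> sub; apply: subset_trans sub _.
  by rewrite subUset sub1set iY.
move=> Z; case: (eqVneq Z Y) => [->|ZY].
  by rewrite tY; apply: leq_trans (profile_le _ _) _.
have [EZ|ZX] := eqVneq Z (i |: X).
  rewrite EZ in ZY *.
  rewrite [profile _ _]eq_card0 // => j; rewrite !inE ffunE.
  by case: ifP => // _; rewrite eq_sym (negPf ZY).
have := TP Z; rewrite /move (negPf ZX) addn0 => le_Z.
apply: leq_trans (leq_trans le_Z (leq_subr _ _)).
apply: subset_leq_card; apply/subsetP=> j; rewrite !inE ffunE.
by case: ifP => // _ /eqP EY; rewrite EY eqxx in ZY.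
Qed.

(** Any matrix embeds in [m] full columns. *)
Lemma full_not_saturated t : 0 < s -> t \in truncations -> setT \notin saturated t.
Proof.
move=> s0; rewrite !inE => /andP [/andP [nd _] _]; apply: contra nd => /eqP tT.
apply/existsP; exists (Ordinal s0); apply/existsP; exists [ffun=> setT].
apply/andP; split; apply/forallP=> X; first by rewrite ffunE subsetT.
have [->|XT] := eqVneq X setT; first by rewrite tT; apply: leq_trans (profile_le _ _) _.
rewrite [profile _ _]eq_card0 // => j; rewrite !inE ffunE eq_sym; exact/negbTE.
Qed.

(** * Least weights, which are the least degrees of generators *)

Definition weight (f : J -> nat) : nat := \sum_X f X * (c - #|X|).

Definition slope t : nat := c - \max_(X in saturated t) #|X|.

(** For [t] in [truncations] this is the least weight in its box at [n = max_size]. Measuring [n]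
    from [max_size], which bounds every sum of a truncation, keeps the subtractions exact. *)
Definition intercept t : nat := weight (fun X => t X) + (max_size - \sum_X t X) * slope t.

Definition cheapest t : {set J} := [set X in saturated t | c - #|X| == slope t].

Lemma slope_le t X : X \in saturated t -> slope t <= c - #|X|.
Proof. by move=> Xt; rewrite leq_sub2l //; apply: leq_bigmax_cond. Qed.

Lemma cheapest_neq0 t : t \in truncations -> cheapest t != set0.
Proof.
rewrite inE => /andP [_]; rewrite -card_gt0 => /(eq_bigmax_cond (fun X : J => #|X|)).
by case=> X Xt maxX; apply/set0Pn; exists X; rewrite inE Xt /slope maxX /=.
Qed.

Lemma slope_gt0 t : 0 < s -> t \in truncations -> 0 < slope t.
Proof.
move=> s0 tP; have /set0Pn [X /[!inE] /andP [Xt /eqP <-]] := cheapest_neq0 tP.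
rewrite subn_gt0 -[ltnRHS]card_ord -cardsT proper_card // properT.
by apply: contraNneq (full_not_saturated s0 tP) => <-; rewrite inE.
Qed.

(** Every column in excess of [t] has a saturated type and costs [slope t] plus a nonnegative
    surcharge; the last sum collects the surcharges. *)
Lemma weight_box n (v : {ffun J -> 'I_n.+1}) t : max_size <= n ->
  v \in box n (saturated t) (fun X => t X) ->
  weight (fun X => v X) = (n - max_size) * slope t + intercept t +
    \sum_X (v X - t X) * (c - #|X| - slope t).
Proof.
move=> le_n; rewrite inE => /andP [/eqP sv /forallP bv].
have le_tv X : t X <= v X by have := bv X; case: ifP => // _ /eqP->.
have -> : weight (fun X => v X) = weight (fun X => t X) +
    \sum_X (v X - t X) * slope t + \sum_X (v X - t X) * (c - #|X| - slope t).
  rewrite -!big_split; apply: eq_bigr => X _ /=.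
  rewrite -addnA -mulnDr; have := bv X; case: ifP => [/slope_le le_s _|_ /eqP->].
    by rewrite subnKC // -mulnDl subnKC.
  by rewrite subnn mul0n addn0.
rewrite -big_distrl sumnB //= sv /intercept; have := sum_truncation_le t.
move: (\sum_X t X) => f le_f; congr addn; rewrite addnCA -mulnDl; congr (_ + _ * _); lia.
Qed.

(** The surcharge vanishes exactly when all excess lies in the cheapest types, so the minimizers
    again form a box and are counted by a polynomial. *)
Lemma min_weight_box n t : t \in truncations -> max_size <= n ->
  [set v in box n (saturated t) (fun X => t X) |
    weight (fun X => v X) == (n - max_size) * slope t + intercept t] =
  box n (cheapest t) (fun X => t X).
Proof.
move=> tP le_n; apply/setP=> v; rewrite inE; apply/andP/idP=> [[bv]|].
  rewrite (weight_box le_n bv) -[eqbRHS]addn0 eqn_add2l sum_nat_eq0 => /forallP ex0.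
  move: bv; rewrite !inE => /andP [-> /forallP bv]; apply/forallP=> X.
  have := bv X; have := ex0 X; rewrite [X \in cheapest t]inE muln_eq0.
  case: ifP => //= /slope_le le_s; rewrite !subn_eq0 eqn_leq le_s andbT.
  by case: ifP => //= _; rewrite orbF eqn_leq => -> ->.
move=> bv; have bv' : v \in box n (saturated t) (fun X => t X).
  move: bv; rewrite !inE => /andP [-> /forallP bv]; apply/forallP=> X.
  have := bv X; rewrite [X \in cheapest t]inE; case: (X \in saturated t) => //=.
  by case: ifP => // _ /eqP->.
split=> //; rewrite (weight_box le_n bv') -[eqbRHS]addn0 eqn_add2l sum_nat_eq0.
apply/forallP=> X; move: bv; rewrite !inE => /andP [_ /forallP/(_ X)].
rewrite [X \in cheapest t]inE; case: ifP => [/andP [_ /eqP-> _]|_ /eqP->].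
  by rewrite subnn muln0.
by rewrite subnn mul0n.
Qed.

(* With M larger than every intercept, minimizing slope * M + intercept
   minimizes the slope first and the intercept second. *)
Lemma eventually_min_truncation : truncations != set0 ->
  exists2 t0, t0 \in truncations & exists M, forall k, M <= k ->
    forall t, t \in truncations ->
    k * slope t0 + intercept t0 <= k * slope t + intercept t
      ?= iff (slope t0 == slope t) && (intercept t0 == intercept t).
Proof.
case/set0Pn=> t1 t1P; pose M := (\sum_t intercept t).+1.
have ltM t : intercept t < M by rewrite ltnS (bigD1 t) //= leq_addr.
pose key t := M * slope t + intercept t.
case: (arg_minnP key t1P) => t0 t0P min_t0; exists t0 => //; exists M => k le_k t tP.
have := min_t0 t tP; have := ltM t0; have := ltM t; rewrite /key => lt lt0 le_key.
have [eq_s|ne_s] := eqVneq (slope t0) (slope t).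
  rewrite eq_s /= in le_key *; split; first by rewrite leq_add2l -(leq_add2l (M * slope t)).
  by rewrite eqn_add2l.
have lt_s : slope t0 < slope t.
  rewrite ltn_neqAle ne_s leqNgt /=; apply/negP=> lt_s.
  have : M * (slope t).+1 <= M * slope t0 by rewrite leq_mul2l lt_s orbT.
  by rewrite mulnS; lia.
have : k * (slope t0).+1 <= k * slope t by rewrite leq_mul2l lt_s orbT.
rewrite mulnS => le_s; apply/leqifP => /=; lia.
Qed.

Lemma sum_poly (T : finType) (P : {set T}) (F : T -> nat -> nat) k n0 :
  (forall x, x \in P -> exists p : {poly rat}, size p <= k /\
     forall n, n0 <= n -> (F x n)%:R%R = p.[n%:R]%R) ->
  exists p : {poly rat}, size p <= k /\
    forall n, n0 <= n -> (\sum_(x in P) F x n)%:R%R = p.[n%:R]%R.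
Proof.
move=> FP; have [p pP] : exists p : T -> {poly rat}, forall x, x \in P ->
    size (p x) <= k /\ forall n, n0 <= n -> (F x n)%:R%R = (p x).[n%:R]%R.
  apply: (@fin_all_exists _ (fun=> {poly rat}) (fun x q => x \in P -> size q <= k /\
    forall n, n0 <= n -> (F x n)%:R%R = q.[n%:R]%R)) => x.
  by have [/FP [q qP]|] := boolP (x \in P); [exists q | exists 0%R].
exists (\sum_(x in P) p x)%R; split=> [|n le_n].
  by apply: leq_trans (size_sum _ _ _) _; apply/bigmax_leqP=> x /pP [].
rewrite horner_sum natr_sum; apply: eq_bigr => x /pP [_ ->] //.
Qed.

Lemma max_vectors_poly : exists p : {poly rat}, size p <= 'C(c, c./2) /\
  forall n, max_size < n -> #|max_vectors n|%:R%R = p.[n%:R]%R.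
Proof.
have [|p [szp pE]] := @sum_poly _ truncations
  (fun t n => #|box n (saturated t) (fun X => t X)|) 'C(c, c./2) max_size.
  move=> t tP; have t0 : saturated t != set0 by move: tP; rewrite inE => /andP [].
  have [p [szp pE]] := box_poly (fun X => t X : nat) t0; exists p; split=> [|n le_n].
    apply: leq_trans szp _; have := sperner (saturated_antichain tP).
    by rewrite card_ord.
  by apply: pE; apply: leq_trans (sum_truncation_le t) le_n.
exists p; split=> // n lt_n; rewrite -pE ?(ltnW lt_n) //; congr (_%:R)%R.
have := card_max_vectors xpredT lt_n.
rewrite (_ : [set v in max_vectors n | xpredT v] = max_vectors n); last first.
  by apply/setP=> v; rewrite inE andbT.
move=> ->; apply: eq_bigr => t _; apply: eq_card => v; by rewrite inE andbT.
Qed.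

Lemma min_weight_poly : 0 < s -> truncations != set0 ->
  exists a e n0, [/\ 0 < a, max_size < n0 &
    exists q : {poly rat}, forall n, n0 <= n ->
    let d := (n - max_size) * a + e in
    [/\ exists2 v, v \in max_vectors n & weight (fun X => v X) = d,
        forall v, v \in max_vectors n -> d <= weight (fun X => v X) &
        #|[set v in max_vectors n | weight (fun X => v X) == d]|%:R%R = q.[n%:R]%R]].
Proof.
move=> s0 /eventually_min_truncation [t0 t0P [M minM]].
(* The threshold ensures both [max_size < n] and [M <= n - max_size]. *)
exists (slope t0), (intercept t0), (max_size + M).+1.
split; [exact: slope_gt0 | by rewrite ltnS leq_addr|].
(* Several truncations may attain the same minimal linear function; each contributes its cheapest
   box, and the others contribute nothing at weight [d]. *)
pose opt := [set t in truncations | (slope t0 == slope t) && (intercept t0 == intercept t)].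
have [|q [_ qE]] := @sum_poly _ opt
  (fun t n => #|box n (cheapest t) (fun X => t X)|) #|J| max_size.
  move=> t /[!inE] /andP [tP _].
  have [|p [szp pE]] := @box_poly _ (cheapest t) (fun X => t X : nat).
    by apply: cheapest_neq0; rewrite inE.
  exists p; split=> [|n le_n]; first by apply: leq_trans szp (max_card _).
  by apply: pE; apply: leq_trans (sum_truncation_le t) le_n.
exists q => n lt_n d.
have lt_sn : max_size < n by apply: leq_trans lt_n; rewrite ltnS leq_addr.
have min_n t : t \in truncations -> d <= (n - max_size) * slope t + intercept t
    ?= iff (slope t0 == slope t) && (intercept t0 == intercept t).
  by apply: minM; rewrite leq_subRL ?(ltnW lt_sn) //; apply: ltnW.
have card_d : #|[set v in max_vectors n | weight (fun X => v X) == d]| =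
    \sum_(t in opt) #|box n (cheapest t) (fun X => t X)|.
  rewrite card_max_vectors // big_mkcond [RHS]big_mkcond; apply: eq_bigr => t _.
  rewrite [in RHS]inE; case: ifP => //= tP; have [le_d eq_d] := min_n t tP.
  case: ifP => opt_t.
    move: eq_d; rewrite opt_t => /eqP ->.
    by rewrite min_weight_box // ltnW.
  apply: eq_card0 => v; rewrite inE; apply/negP=> /andP [bv /eqP wv].
  have := weight_box (ltnW lt_sn) bv; rewrite wv.
  move: le_d; rewrite leq_eqVlt eq_d opt_t /=; lia.
split.
- have : 0 < #|[set v in max_vectors n | weight (fun X => v X) == d]|.
    rewrite card_d (bigD1 t0) /=; last by rewrite inE t0P !eqxx.
    rewrite card_box ?cheapest_neq0 //; last first.
      exact: leq_trans (sum_truncation_le _) (ltnW lt_sn).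
    by rewrite addn_gt0 bin_gt0 leq_addl.
  by case/card_gt0P=> v /[!inE] /andP [vM /eqP]; exists v; rewrite ?inE.
- move=> v vM; have := truncation_box v (truncation v) lt_sn; rewrite vM eqxx /=.
  case/esym/andP=> tP bv; rewrite (weight_box (ltnW lt_sn) bv).
  by have [le_d _] := min_n _ tP; apply: leq_trans le_d (leq_addr _ _).
- by rewrite card_d qE // ltnW.
Qed.

(** An independent family of largest total size is maximal, since adding a row to a column increases
    that size. *)
Lemma exists_maximal_independent n (S0 : 'I_n -> J) : ~~ dependent A (profile S0) ->
  exists S : 'I_n -> J, maximal_independent A (profile S).
Proof.
move=> nd; have nd' : ~~ dependent A (profile (finfun S0)).
  rewrite (@eq_dependent _ _ _ A _ (profile S0)) // => X; congr minn.
  by apply: eq_card => j; rewrite !inE ffunE.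
pose size_sum (S : {ffun 'I_n -> J}) := \sum_j #|S j|.
case: (arg_maxnP (P := fun S : {ffun 'I_n -> J} => ~~ dependent A (profile S))
  size_sum nd') => S ndS maxS.
exists S; apply/maximal_independentP; split=> // i j Sij; apply: contraT => nd_ij; exfalso.
have dep_ij : dependent A (profile (finfun (recolumn S j (i |: S j)))) =
              dependent A (profile (recolumn S j (i |: S j))).
  by apply: eq_dependent => X; congr minn; apply: eq_card => k; rewrite !inE ffunE.
have : size_sum (finfun (recolumn S j (i |: S j))) <= size_sum S.
  by apply: maxS; rewrite dep_ij.
rewrite /size_sum leqNgt (bigD1 j) //= [ltnRHS](bigD1 j) //=.
rewrite ffunE /recolumn eqxx cardsU1 Sij add1n -addSn leq_add2l => /negP; apply.
by apply: leq_sum => k /negPf kj; rewrite ffunE kj.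
Qed.

Definition profile_vector n (S : 'I_n -> J) : {ffun J -> 'I_n.+1} :=
  [ffun X => inord (profile S X)].

Lemma profile_vectorE n (S : 'I_n -> J) X : profile_vector S X = profile S X :> nat.
Proof. by rewrite ffunE inordK // ltnS profile_le. Qed.

Lemma eq_profile_vector n (S S' : 'I_n -> J) :
  profile_vector S = profile_vector S' <-> profile S =1 profile S'.
Proof.
split=> [E X|E]; first by rewrite -!profile_vectorE E.
by apply/ffunP=> X; rewrite !ffunE E.
Qed.

Lemma mem_max_vectors n (S : 'I_n -> J) :
  (profile_vector S \in max_vectors n) = maximal_independent A (profile S).
Proof.
rewrite inE; have -> : \sum_X profile_vector S X = n.
  under eq_bigr => X _ do rewrite profile_vectorE -[profile _ _]muln1.
  by rewrite (sum_profile S (fun=> 1)) sum1_card card_ord.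
rewrite eqxx; apply: eq_maximal_independent => X; by rewrite profile_vectorE.
Qed.

(** List [v X] copies of each type [X]. *)
Lemma profile_vector_surj n (v : {ffun J -> 'I_n.+1}) : \sum_X v X = n ->
  exists S : 'I_n -> J, profile_vector S = v.
Proof.
move=> sv; pose r := flatten [seq nseq (v X) X | X <- enum J].
have cr X : count_mem X r = v X.
  rewrite count_flatten -map_comp sumnE big_map big_enum (bigD1 X) //=.
  rewrite count_nseq /= eqxx mul1n big1 ?addn0 // => Y /negPf YX.
  by rewrite count_nseq /= YX.
have sr : size r == n.
  rewrite size_flatten sumnE big_map big_map big_enum -[X in _ == X]sv /=.
  by apply/eqP; apply: eq_bigr => X _; rewrite size_nseq.
exists (tnth (Tuple sr)); apply/ffunP=> X; apply: val_inj.
by rewrite /= profile_vectorE -count_profile map_tnth_enum /= cr.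
Qed.

Lemma truncations_neq0 n : max_size < n -> max_vectors n != set0 -> truncations != set0.
Proof.
move=> lt_n /set0Pn [v vM]; apply/set0Pn; exists (truncation v).
by have := truncation_box v (truncation v) lt_n; rewrite vM eqxx /= => /esym /andP [].
Qed.

End Counting.

(** * Orbits of minimal generators *)

Section OrbitCount.
Variables (K : fieldType) (c n : nat).
Local Notation J := {set 'I_c}.

(** The profile is a complete orbit invariant, so one vertex set chosen for each vector of [D] gives
    the representatives. *)
Lemma orbit_count_profiles (G : 'X_{1..c * n} -> Prop) (D : {set {ffun J -> 'I_n.+1}}) :
  (forall v, v \in D -> (\sum_X v X = n)%N) ->
  (forall u, G u <-> exists2 U, profile_vector (coltype U) \in D & u = mset U) ->
  orbit_count K G #|D|.
Proof.
move=> sD GD; have [U UD] : exists U : 'I_#|D| -> {set 'I_(c * n)},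
    forall k, profile_vector (coltype (U k)) = enum_val k.
  apply: (@fin_all_exists _ (fun=> {set 'I_(c * n)})
            (fun k U => profile_vector (coltype U) = enum_val k)) => k.
  have [S <-] := profile_vector_surj (sD _ (enum_valP k)).
  by have [U US] := coltype_surj S; exists U; apply/eq_profile_vector=> X;
     apply: eq_card => j; rewrite !inE US.
exists (fun k => mset (U k)); split=> [k|k l|u].
- by apply/GD; exists (U k); rewrite // UD enum_valP.
- by move=> /same_orbit_mset /eq_profile_vector; rewrite !UD => /enum_val_inj.
- case/GD=> V VD ->; exists (enum_rank_in VD (profile_vector (coltype V))).
  apply/same_orbit_mset/eq_profile_vector; rewrite UD enum_rankK_in //.
Qed.

End OrbitCount.



(** * Generators of the dual in terms of maximal vectors *)

Section DualGenerators.
Variables (K : fieldType) (c m s : nat) (A : 'I_s -> 'M[bool]_(c, m)).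
Variables (n : nat) (le_mn : (m <= n)%N).
Local Notation dual_gen := (min_gen (alexander_dual (sym_ideal K A le_mn))).

Lemma dual_gen_profile u : dual_gen u <->
  exists2 U, profile_vector (coltype U) \in max_vectors A n & u = mset U.
Proof.
rewrite min_gen_sym_ideal; split=> -[U mU ->]; exists U => //.
  by rewrite mem_max_vectors.
by rewrite -mem_max_vectors.
Qed.

Lemma mdeg_profile (U : {set 'I_(c * n)}) :
  mdeg (mset U) = weight (fun X => profile_vector (coltype U) X).
Proof.
rewrite mdeg_coltype; apply: eq_bigr => X _; by rewrite profile_vectorE.
Qed.

Lemma max_vectors_sum v : v \in max_vectors A n -> (\sum_X v X = n)%N.
Proof. by rewrite inE => /andP [/eqP]. Qed.

Lemma orbit_count_dual_gen : orbit_count K dual_gen #|max_vectors A n|.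
Proof. exact: orbit_count_profiles max_vectors_sum dual_gen_profile. Qed.

Lemma orbit_count_dual_gen_degree d :
  orbit_count K (fun u => dual_gen u /\ mdeg u = d)
    #|[set v in max_vectors A n | weight (fun X => v X) == d]|.
Proof.
apply: orbit_count_profiles => [v|u]; first by rewrite inE => /andP [/max_vectors_sum].
rewrite dual_gen_profile; split=> [[[U mU ->]]|[U]].
  by rewrite mdeg_profile => /eqP wU; exists U; rewrite // inE mU.
by rewrite inE => /andP [mU /eqP wU] ->; rewrite mdeg_profile; split=> //; exists U.
Qed.

Lemma least_degree_dual_gen d :
  (exists2 v, v \in max_vectors A n & weight (fun X => v X) = d) ->
  (forall v, v \in max_vectors A n -> (d <= weight (fun X => v X))%N) ->
  least_degree dual_gen d.
Proof.
move=> [v vM wv] min_d; split=> [|u /dual_gen_profile [U mU ->]]; last first.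
  by rewrite mdeg_profile min_d.
have [S ES] := profile_vector_surj (max_vectors_sum vM).
have [U US] := coltype_surj S.
have EU : profile_vector (coltype U) = v.
  by rewrite -ES; apply/eq_profile_vector=> X; apply: eq_card => j; rewrite !inE US.
exists (mset U); last by rewrite mdeg_profile EU.
by apply/dual_gen_profile; exists U; rewrite ?EU.
Qed.

(** An edge missed by the full vertex set would be empty and put 1 in the ideal; so the family of
    empty types is independent and extends to a maximal one. *)
Lemma max_vectors_neq0 : ~ sym_ideal K A le_mn 1 -> max_vectors A n != set0.
Proof.
move=> I1; have [|S mS] := @exists_maximal_independent _ _ _ A n (coltype setT).
  rewrite -(no_edge_independent _ le_mn); apply/exists_inP=> -[E HE].
  rewrite setIT => /eqP E0; apply: I1; apply/sym_ideal_edges.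
  rewrite -mpolyX0; apply/edge_idealX/exists_inP; exists E => //.
  by rewrite E0 sub0set.
by apply/set0Pn; exists (profile_vector S); rewrite mem_max_vectors.
Qed.

End DualGenerators.

Theorem theorem8p9 (K : fieldType) (c m s : nat)
    (hc : (0 < c)%N) (hm : (0 < m)%N) (hs : (0 < s)%N)
    (A : 'I_s -> 'M[bool]_(c, m))
    (hnz : forall n (le_mn : (m <= n)%N),
       exists2 f, sym_ideal K A le_mn f & f != 0) :
  (exists p : {poly rat},
     (size p <= 'C(c, c./2))%N /\
     exists n0 : nat, forall n (le_mn : (m <= n)%N), (n0 <= n)%N ->
       exists N : nat,
         N%:R = p.[n%:R] /\
         orbit_count K (min_gen (alexander_dual (sym_ideal K A le_mn))) N)
  /\
  (exists d : nat -> nat,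
     linear_pos_fun d /\
     (exists n0 : nat, forall n (le_mn : (m <= n)%N), (n0 <= n)%N ->
        ~ sym_ideal K A le_mn 1 ->
        least_degree (min_gen (alexander_dual (sym_ideal K A le_mn))) (d n)) /\
     (exists q : {poly rat},
        exists n0 : nat, forall n (le_mn : (m <= n)%N), (n0 <= n)%N ->
          exists N : nat,
            N%:R = q.[n%:R] /\
            orbit_count K
              (fun u => min_gen (alexander_dual (sym_ideal K A le_mn)) u /\
                        mdeg u = d n) N)).
Proof.
split.
  have [p [szp pE]] := max_vectors_poly A.
  exists p; split=> //; exists (max_size c m).+1 => n le_mn lt_n.
  exists #|max_vectors A n|; split; [exact: pE | exact: orbit_count_dual_gen].
(* Without truncations the dual has no minimal generators for large [n]. The least degree claim is
   then vacuous, so any linear [d] serves, and the count is zero. *)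
have [tr0|tr0] := eqVneq (truncations A) set0.
  have M0 n : (max_size c m < n)%N -> max_vectors A n = set0.
    move=> lt_n; apply/eqP; apply: contraTT isT => /(truncations_neq0 lt_n).
    by rewrite tr0 eqxx.
  exists id; split; [|split].
  - by split=> //; exists 1%N, 0, 0%N; split=> // n _; rewrite mul1r addr0.
  - exists (max_size c m).+1 => n le_mn lt_n /max_vectors_neq0.
    by rewrite M0 // eqxx.
  - exists 0, (max_size c m).+1 => n le_mn lt_n; exists 0%N; split.
      by rewrite horner0.
    have := orbit_count_dual_gen_degree K A le_mn n.
    rewrite [X in orbit_count _ _ X](_ : _ = 0%N) //.
    by apply: eq_card0 => v; rewrite inE M0 // inE.
have [a [e [n0 [a0 lt_n0 [q qP]]]]] := min_weight_poly hs tr0.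
(* The maximum with 1 only ensures positive values for small [n]; from [n0] on, [a > 0] and
   [n > max_size] make it redundant. *)
exists (fun n => maxn 1 ((n - max_size c m) * a + e)).
have dE n : (n0 <= n)%N -> maxn 1 ((n - max_size c m) * a + e) =
    ((n - max_size c m) * a + e)%N.
  move=> le_n; apply/maxn_idPr; apply: leq_trans (leq_addr _ _).
  by rewrite muln_gt0 a0 andbT subn_gt0 (leq_trans lt_n0).
split; [|split].
- split=> [n _|]; first by rewrite leq_max.
  exists a, (e%:Z - (max_size c m * a)%:Z), n0; split=> // n le_n; rewrite dE //.
  have le_sn : (max_size c m <= n)%N by apply: ltnW; apply: leq_trans le_n.
  rewrite mulnBl PoszD -subzn ?leq_mul2r ?le_sn ?orbT // !PoszM; lia.
- exists n0 => n le_mn le_n _; rewrite dE //; have [ex min _] := qP n le_n.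
  exact: least_degree_dual_gen.
- exists q, n0 => n le_mn le_n; rewrite dE //; have [_ _ qE] := qP n le_n.
  by eexists; split; [exact: qE | exact: orbit_count_dual_gen_degree].
Qed.
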